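(* Let $m\ge n\ge 2$, and let $A\in\mathbb{R}^{m\times n}$ have simple singular values $\sigma_1>\sigma_2>\cdots>\sigma_n>0$ with corresponding left singular vectors $u_1,\ldots,u_n$ and right singular vectors $v_1,\ldots,v_n$. Let $b\in\mathbb{R}^m$ satisfy $u_j^Tb\ne0$ for $j=1,\ldots,n$. Assume that the problem $\min_{x\in\mathbb{R}^n}\|Ax-b\|$ is severely or moderately ill-posed. Let $1\le k\le n-1$, let $P_{k+1},B_k,Q_k$ be the matrices produced by $k$ steps of Lanczos bidiagonalization of $A$ started with $p_1=b/\|b\|$, and put $$\gamma_k=\|A-P_{k+1}B_kQ_k^T\|.$$ Let $\mathcal{V}_k=\mathrm{span}\{v_1,\ldots,v_k\}$ and $\mathcal{V}_k^s=\mathcal{K}_k(A^TA,A^Tb)$. Then $$\sigma_{k+1}\le\gamma_k\le\sigma_{k+1}+\sigma_1\,\|\sin\Theta(\mathcal{V}_k,\mathcal{V}_k^s)\|.$$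
   Context: $\|\cdot\|$ is the Euclidean norm of a vector or the spectral norm of a matrix. All computations are in exact arithmetic. $\mathcal{K}_k(M,w)=\mathrm{span}\{w,Mw,\ldots,M^{k-1}w\}$. Ill-posedness: the problem is called moderately ill-posed if $\sigma_j=\mathcal{O}(j^{-\alpha})$, $j=1,\ldots,n$, for some $\alpha>1$, and severely ill-posed if $\sigma_j=\mathcal{O}(e^{-\alpha j})$, $j=1,\ldots,n$, for some $\alpha>0$ (considerably). This is a description of the decay of the singular values. Lanczos bidiagonalization: starting from $p_1=b/\|b\|$ and $\alpha_1q_1=A^Tp_1$, for $i=1,2,\ldots$ compute $\beta_{i+1}p_{i+1}=Aq_i-\alpha_ip_i$ and $\alpha_{i+1}q_{i+1}=A^Tp_{i+1}-\beta_{i+1}q_i$, where $\alpha_i,\beta_i>0$ are chosen so that all $p_i\in\mathbb{R}^m$ and $q_i\in\mathbb{R}^n$ have unit norm. Under the stated assumptions no breakdown occurs for $k\le n-1$. The matrices $Q_k=(q_1,\ldots,q_k)$ and $P_{k+1}=(p_1,\ldots,p_{k+1})$ have orthonormal columns, the columns of $Q_k$ form a basis of $\mathcal{K}_k(A^TA,A^Tb)$, and $B_k\in\mathbb{R}^{(k+1)\times k}$ is the lower bidiagonal matrix with diagonal entries $\alpha_1,\ldots,\alpha_k$ and subdiagonal entries $\beta_2,\ldots,\beta_{k+1}$. They satisfy $$AQ_k=P_{k+1}B_k,\qquad A^TP_{k+1}=Q_kB_k^T+\alpha_{k+1}q_{k+1}e_{k+1}^T,$$ where $e_{k+1}$ is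 the last canonical basis vector of $\mathbb{R}^{k+1}$. For two $k$-dimensional subspaces $\mathcal{X},\mathcal{Y}$ of $\mathbb{R}^n$, $\Theta(\mathcal{X},\mathcal{Y})$ denotes the diagonal matrix of canonical (principal) angles between them; thus $\|\sin\Theta(\mathcal{X},\mathcal{Y})\|=\|X_\perp^TY\|$, where the columns of $Y$ form an orthonormal basis of $\mathcal{Y}$ and the columns of $X_\perp$ form an orthonormal basis of the orthogonal complement of $\mathcal{X}$. *)

(* Defs.v *)
From HB Require Import structures.
From mathcomp Require Import all_boot all_order all_algebra.
From mathcomp Require Import classical_sets reals sequences exp trigo.

Set Implicit Arguments.
Unset Strict Implicit.
Unset Printing Implicit Defensive.

Import Order.TTheory GRing.Theory Num.Theory.
Local Open Scope classical_set_scope.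
Local Open Scope ring_scope.

(* Indices are shifted throughout: the object written x_j in 1-based notation
   is the one with index j - 1 here. *)

Definition enorm (R : realType) (n : nat) (x : 'cV[R]_n) : R :=
  Num.sqrt (\sum_(i < n) x i 0 ^+ 2).

Definition spectral_norm (R : realType) (m n : nat) (M : 'M[R]_(m, n)) : R :=
  sup [set enorm (M *m x) | x in [set x : 'cV[R]_n | enorm x = 1]].

(* Thin singular value decomposition; U has as many columns as M, so this can
   only hold when n <= m. *)
Definition is_svd (R : realType) (m n : nat) (M : 'M[R]_(m, n))
    (U : 'M[R]_(m, n)) (s : 'rV[R]_n) (V : 'M[R]_n) : Prop :=
  [/\ U^T *m U = 1%:M, V^T *m V = 1%:M, M = U *m diag_mx s *m V^T,
      forall j : 'I_n, 0 <= s 0 j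
    & forall i j : 'I_n, (i <= j)%N -> s 0 j <= s 0 i].

Definition moderately_ill_posed (R : realType) (n : nat) (s : 'rV[R]_n) : Prop :=
  exists2 a : R, 1 < a &
    exists C : R, forall j : 'I_n, s 0 j <= C * j.+1%:R `^ (- a).

Definition severely_ill_posed (R : realType) (n : nat) (s : 'rV[R]_n) : Prop :=
  exists2 a : R, 0 < a &
    exists C : R, forall j : 'I_n, s 0 j <= C * expR (- a * j.+1%:R).

(* lanczos A b i = (beta_(i+1), p_(i+1), alpha_(i+1), q_(i+1)), where by
   convention beta_1 = ||b||. A breakdown (a zero vector to normalize) yields
   a zero vector, as 0^-1 = 0. *)
Fixpoint lanczos (R : realType) (m n : nat) (A : 'M[R]_(m, n)) (b : 'cV[R]_m)
    (i : nat) : R * 'cV[R]_m * R * 'cV[R]_n :=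
  match i with
  | 0%N =>
      let beta := enorm b in
      let p := beta^-1 *: b in
      let t := A^T *m p in
      let alpha := enorm t in
      (beta, p, alpha, alpha^-1 *: t)
  | i'.+1 =>
      let: (_, p, alpha, q) := lanczos A b i' in
      let r := A *m q - alpha *: p in
      let beta' := enorm r in
      let p' := beta'^-1 *: r in
      let t := A^T *m p' - beta' *: q in
      let alpha' := enorm t in
      (beta', p', alpha', alpha'^-1 *: t)
  end.

Definition lanczos_beta (R : realType) (m n : nat) (A : 'M[R]_(m, n))
    (b : 'cV[R]_m) (i : nat) : R := (lanczos A b i).1.1.1.

Definition lanczos_p (R : realType) (m n : nat) (A : 'M[R]_(m, n))
    (b : 'cV[R]_m) (i : nat) : 'cV[R]_m := (lanczos A b i).1.1.2.

Definition lanczos_alpha (R : realType) (m n : nat) (A : 'M[R]_(m, n))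
    (b : 'cV[R]_m) (i : nat) : R := (lanczos A b i).1.2.

Definition lanczos_q (R : realType) (m n : nat) (A : 'M[R]_(m, n))
    (b : 'cV[R]_m) (i : nat) : 'cV[R]_n := (lanczos A b i).2.

(* lanczos_P A b k is the m x k matrix P_k, so that P_(k+1) is
   lanczos_P A b k.+1. *)
Definition lanczos_P (R : realType) (m n : nat) (A : 'M[R]_(m, n))
    (b : 'cV[R]_m) (k : nat) : 'M[R]_(m, k) :=
  \matrix_(i < m, j < k) lanczos_p A b j i 0.

Definition lanczos_Q (R : realType) (m n : nat) (A : 'M[R]_(m, n))
    (b : 'cV[R]_m) (k : nat) : 'M[R]_(n, k) :=
  \matrix_(i < n, j < k) lanczos_q A b j i 0.

Definition lanczos_B (R : realType) (m n : nat) (A : 'M[R]_(m, n))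
    (b : 'cV[R]_m) (k : nat) : 'M[R]_(k.+1, k) :=
  \matrix_(i < k.+1, j < k)
    if i == j :> nat then lanczos_alpha A b j
    else if i == j.+1 :> nat then lanczos_beta A b i
    else 0.

Definition krylov (R : realType) (n : nat) (M : 'M[R]_n) (w : 'cV[R]_n)
    (k : nat) : {vspace 'cV[R]_n} :=
  <<[seq iter i (mulmx M) w | i <- iota 0 k]>>%VS.

Definition lead_colspan (R : realType) (m n : nat) (M : 'M[R]_(m, n)) (k : nat) :
    {vspace 'cV[R]_m} :=
  <<[seq col j M | j : 'I_n <- enum 'I_n & (j < k)%N]>>%VS.

Definition orthonormal_basis (R : realType) (n k : nat) (X : 'M[R]_(n, k))
    (S : {vspace 'cV[R]_n}) : Prop :=
  X^T *m X = 1%:M /\ lead_colspan X k = S.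

(* theta lists the canonical angles between the k-dimensional subspaces S and
   T: the arc cosines of the singular values of X^T Y, for X and Y orthonormal
   bases of S and T. *)
Definition canonical_angles (R : realType) (n k : nat)
    (S T : {vspace 'cV[R]_n}) (theta : 'rV[R]_k) : Prop :=
  exists (X Y : 'M[R]_(n, k)) (W : 'M[R]_k) (c : 'rV[R]_k) (Z : 'M[R]_k),
    [/\ orthonormal_basis X S, orthonormal_basis Y T,
        is_svd (X^T *m Y) W c Z & theta = map_mx (@acos R) c].

Definition sin_Theta (R : realType) (k : nat) (theta : 'rV[R]_k) : 'M[R]_k :=
  diag_mx (map_mx (@sin R) theta).

(* Main.v *)
(* Since A Q_k = P_(k+1) B_k, the matrix whose norm is gamma_k is A (1 - Q_k Q_k^T).
   Lower bound: some unit vector of span(v_1, ..., v_(k+1)) is killed by Q_k^T.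
   Upper bound: with Pi = Q_k Q_k^T the orthogonal projector onto the Krylov
   space and X X^T the one onto V_k, split
     A (1 - Pi) = A (1 - X X^T) (1 - Pi) + A X X^T (1 - Pi);
   the norm of A (1 - X X^T) is sigma_(k+1) and that of X^T (1 - Pi) is
   ||sin Theta||.  The hypothesis on the angles provides an orthonormal family
   of k vectors spanning the Krylov space, which rules out a breakdown. *)

Require Import Defs.
From HB Require Import structures.
From mathcomp Require Import all_boot all_order all_algebra.
From mathcomp Require Import classical_sets reals sequences exp trigo.
From mathcomp Require Import ring lra.

Set Implicit Arguments.
Unset Strict Implicit.
Unset Printing Implicit Defensive.

Import Order.TTheory GRing.Theory Num.Theory.
Local Open Scope ring_scope.

(** * Inner product, Cauchy-Schwarz and the Euclidean norm *)

Definition dotv (R : realType) (n : nat) (x y : 'cV[R]_n) : R := (x^T *m y) 0 0.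

Lemma dotvE (R : realType) (n : nat) (x y : 'cV[R]_n) :
  dotv x y = \sum_(i < n) x i 0 * y i 0.
Proof. by rewrite /dotv mxE; apply: eq_bigr => i _; rewrite mxE. Qed.

Lemma dotvC (R : realType) (n : nat) (x y : 'cV[R]_n) : dotv x y = dotv y x.
Proof. by rewrite !dotvE; apply: eq_bigr => i _; rewrite mulrC. Qed.

Lemma dotvDl (R : realType) (n : nat) (x y z : 'cV[R]_n) :
  dotv (x + y) z = dotv x z + dotv y z.
Proof. by rewrite /dotv linearD mulmxDl mxE. Qed.

Lemma dotvZl (R : realType) (n : nat) (a : R) (x z : 'cV[R]_n) :
  dotv (a *: x) z = a * dotv x z.
Proof. by rewrite /dotv linearZ -scalemxAl mxE. Qed.

Lemma dotvBl (R : realType) (n : nat) (x y z : 'cV[R]_n) :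
  dotv (x - y) z = dotv x z - dotv y z.
Proof. by rewrite dotvDl -scaleN1r dotvZl mulN1r. Qed.

Lemma dotvDr (R : realType) (n : nat) (x y z : 'cV[R]_n) :
  dotv x (y + z) = dotv x y + dotv x z.
Proof. by rewrite dotvC dotvDl !(dotvC x). Qed.

Lemma dotvZr (R : realType) (n : nat) (a : R) (x z : 'cV[R]_n) :
  dotv x (a *: z) = a * dotv x z.
Proof. by rewrite dotvC dotvZl dotvC. Qed.

Lemma dotvBr (R : realType) (n : nat) (x y z : 'cV[R]_n) :
  dotv x (y - z) = dotv x y - dotv x z.
Proof. by rewrite dotvC dotvBl !(dotvC x). Qed.

Lemma dotv0l (R : realType) (n : nat) (x : 'cV[R]_n) : dotv 0 x = 0.
Proof. by rewrite -(scale0r 0) dotvZl mul0r. Qed.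

Lemma dotv0r (R : realType) (n : nat) (x : 'cV[R]_n) : dotv x 0 = 0.
Proof. by rewrite dotvC dotv0l. Qed.

Lemma dotv_mull (R : realType) (m n : nat) (M : 'M[R]_(m, n))
    (x : 'cV_n) (y : 'cV_m) :
  dotv (M *m x) y = dotv x (M^T *m y).
Proof. by rewrite /dotv trmx_mul mulmxA. Qed.

Lemma dotv_ge0 (R : realType) (n : nat) (x : 'cV[R]_n) : 0 <= dotv x x.
Proof. by rewrite dotvE sumr_ge0 // => i _; rewrite -expr2 sqr_ge0. Qed.

Lemma dotv_eq0 (R : realType) (n : nat) (x : 'cV[R]_n) : dotv x x = 0 -> x = 0.
Proof.
rewrite dotvE => /eqP; rewrite psumr_eq0 => [/allP h|i _]; last first.
  by rewrite -expr2 sqr_ge0.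
apply/matrixP => i j; rewrite ord1 mxE.
by have := h i (mem_index_enum _); rewrite /= mulf_eq0 orbb => /eqP.
Qed.

Lemma dotv_cauchy (R : realType) (n : nat) (x y : 'cV[R]_n) :
  dotv x y ^+ 2 <= dotv x x * dotv y y.
Proof.
have [y0|y0] := eqVneq (dotv y y) 0.
  by rewrite (dotv_eq0 y0) !dotv0r mulr0 expr2 mulr0.
have yp : 0 < dotv y y by rewrite lt_neqAle eq_sym y0 dotv_ge0.
(* This vector is [dotv y y] times the component of [x] orthogonal to [y]. Its squared length is
   [dotv y y] times the Cauchy-Schwarz gap. *)
have := dotv_ge0 (dotv y y *: x - dotv x y *: y).
rewrite dotvBl !dotvBr !dotvZl !dotvZr (dotvC y x).
set a := dotv x x; set c := dotv x y; set d := dotv y y in y0 yp * => h.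
rewrite -subr_ge0 -(pmulr_rge0 _ yp); congr (0 <= _) : h; ring.
Qed.

Lemma enormE (R : realType) (n : nat) (x : 'cV[R]_n) : enorm x = Num.sqrt (dotv x x).
Proof. by rewrite dotvE /enorm. Qed.

Lemma enorm_ge0 (R : realType) (n : nat) (x : 'cV[R]_n) : 0 <= enorm x.
Proof. exact: sqrtr_ge0. Qed.

Lemma enorm_sqr (R : realType) (n : nat) (x : 'cV[R]_n) : enorm x ^+ 2 = dotv x x.
Proof. by rewrite enormE sqr_sqrtr // dotv_ge0. Qed.

Lemma enorm_eq0 (R : realType) (n : nat) (x : 'cV[R]_n) : enorm x = 0 -> x = 0.
Proof. by move=> h; apply: dotv_eq0; rewrite -enorm_sqr h expr2 mulr0. Qed.

Lemma enorm0 (R : realType) (n : nat) : enorm (0 : 'cV[R]_n) = 0.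
Proof. by rewrite enormE dotv0l sqrtr0. Qed.

Lemma enormZ (R : realType) (n : nat) (a : R) (x : 'cV[R]_n) :
  enorm (a *: x) = `|a| * enorm x.
Proof.
by rewrite !enormE dotvZl dotvZr mulrA -expr2 sqrtrM ?sqr_ge0 // sqrtr_sqr.
Qed.

Lemma dotv_le_enorm (R : realType) (n : nat) (x y : 'cV[R]_n) :
  dotv x y <= enorm x * enorm y.
Proof.
apply: le_trans (ler_norm _) _.
rewrite -ler_sqr ?nnegrE ?mulr_ge0 ?enorm_ge0 //.
by rewrite real_normK ?num_real // exprMn !enorm_sqr dotv_cauchy.
Qed.

Lemma enormD (R : realType) (n : nat) (x y : 'cV[R]_n) :
  enorm (x + y) <= enorm x + enorm y.
Proof.
rewrite -ler_sqr ?nnegrE ?addr_ge0 ?enorm_ge0 //.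
rewrite enorm_sqr sqrrD !enorm_sqr dotvDl !dotvDr (dotvC y x).
have := dotv_le_enorm x y; lra.
Qed.

Lemma enorm_le_dotv (R : realType) (m n : nat) (x : 'cV[R]_m) (y : 'cV[R]_n)
    (c : R) :
  0 <= c -> dotv x x <= c ^+ 2 * dotv y y -> enorm x <= c * enorm y.
Proof.
move=> c0 h; rewrite -ler_sqr ?nnegrE ?mulr_ge0 ?enorm_ge0 //.
by rewrite exprMn !enorm_sqr.
Qed.

(** * Spectral norm *)

(** Cauchy-Schwarz applied to each row gives the Frobenius norm as a bound. It serves to show that
    the set under the supremum in [spectral_norm] is bounded above. *)
Lemma enorm_mulmx_bounded (R : realType) (m n : nat) (M : 'M[R]_(m, n))
    (x : 'cV[R]_n) :
  enorm (M *m x) <= Num.sqrt (\sum_i dotv (row i M)^T (row i M)^T) * enorm x.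
Proof.
have s0 : 0 <= \sum_i dotv (row i M)^T (row i M)^T.
  by apply: sumr_ge0 => i _; apply: dotv_ge0.
apply: enorm_le_dotv; first exact: sqrtr_ge0.
rewrite sqr_sqrtr // mulr_suml dotvE ler_sum // => i _.
suff -> : (M *m x) i 0 = dotv (row i M)^T x by rewrite -expr2 dotv_cauchy.
by rewrite dotvE mxE; apply: eq_bigr => j _; rewrite !mxE.
Qed.

Lemma enorm_mulmx (R : realType) (m n : nat) (M : 'M[R]_(m, n)) (x : 'cV[R]_n) :
  enorm (M *m x) <= spectral_norm M * enorm x.
Proof.
have [x0|x0] := eqVneq (enorm x) 0.
  by rewrite (enorm_eq0 x0) mulmx0 !enorm0 mulr0.
have xp : 0 < enorm x by rewrite lt_neqAle eq_sym x0 enorm_ge0.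
rewrite -ler_pdivrMr // mulrC -[(enorm x)^-1]ger0_norm ?invr_ge0 ?enorm_ge0 //.
rewrite -enormZ scalemxAr; apply: ub_le_sup.
  exists (Num.sqrt (\sum_i dotv (row i M)^T (row i M)^T)) => _ [y /= y1 <-].
  by have := enorm_mulmx_bounded M y; rewrite y1 mulr1.
exists ((enorm x)^-1 *: x) => //=.
by rewrite enormZ ger0_norm ?invr_ge0 ?enorm_ge0 // mulVf.
Qed.

Lemma dotv_delta (R : realType) (n : nat) (i : 'I_n) (x : 'cV[R]_n) :
  dotv (delta_mx i 0) x = x i 0.
Proof.
rewrite dotvE (bigD1 i) //= mxE !eqxx mul1r big1 ?addr0 // => j ji.
by rewrite mxE (negPf ji) mul0r.
Qed.

Lemma enorm_delta (R : realType) (n : nat) (i : 'I_n) :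
  enorm (delta_mx i 0 : 'cV[R]_n) = 1.
Proof. by rewrite enormE dotv_delta mxE !eqxx sqrtr1. Qed.

(** The condition [0 < n] supplies a unit vector, so the supremum is over a nonempty set; for
    [n = 0] it would be a default value. *)
Lemma spectral_norm_le (R : realType) (m n : nat) (M : 'M[R]_(m, n)) (c : R) :
  (0 < n)%N -> (forall x, enorm x = 1 -> enorm (M *m x) <= c) ->
  spectral_norm M <= c.
Proof.
move=> n0 h; apply: ge_sup => [|_ [x /= x1 <-]]; last exact: h.
exists (enorm (M *m delta_mx (Ordinal n0) 0)), (delta_mx (Ordinal n0) 0) => //=.
exact: enorm_delta.
Qed.

Lemma spectral_norm_ge0 (R : realType) (m n : nat) (M : 'M[R]_(m, n)) :
  (0 < n)%N -> 0 <= spectral_norm M.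
Proof.
move=> n0; have := enorm_mulmx M (delta_mx (Ordinal n0) 0).
by rewrite enorm_delta mulr1; apply: le_trans; apply: enorm_ge0.
Qed.

(** Test the norm on a basis vector. Applied to [sin_Theta], this bounds the sine of each single
    angle. *)
Lemma spectral_norm_diag_ge (R : realType) (n : nat) (d : 'rV[R]_n) (j : 'I_n) :
  `|d 0 j| <= spectral_norm (diag_mx d).
Proof.
have := enorm_mulmx (diag_mx d) (delta_mx j 0).
suff -> : diag_mx d *m delta_mx j 0 = d 0 j *: delta_mx j 0 :> 'cV_n.
  by rewrite enormZ enorm_delta !mulr1.
apply/matrixP => i l; rewrite mul_diag_mx !mxE.
by case: eqP => [->|]; rewrite ?mulr0.
Qed.

(** * Spans and factorization through columns *)

Lemma span_ind (K : fieldType) (vT : vectType K) (X : seq vT) (P : vT -> Prop) :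
  P 0 -> (forall a u v, P u -> P v -> P (a *: u + v)) ->
  (forall u, u \in X -> P u) -> forall v, v \in <<X>>%VS -> P v.
Proof.
move=> P0 PD PX v; rewrite -[X in span X]/(val (in_tuple X)) => /coord_span ->.
elim/big_rec: _ => // i u _ Pu; apply: PD => //; apply: PX.
by rewrite mem_nth.
Qed.

Lemma mem_lead_colspan (R : realType) (n k : nat) (X : 'M[R]_(n, k))
    (l : nat) (v : 'cV_n) :
  v \in lead_colspan X l -> exists c, v = X *m c.
Proof.
rewrite /lead_colspan; apply: (@span_ind _ _ _ (fun v => exists c, v = X *m c)).
- by exists 0; rewrite mulmx0.
- by move=> a _ _ [c ->] [d ->]; exists (a *: c + d); rewrite mulmxDr scalemxAr.
by move=> _ /mapP[j _ ->]; exists (delta_mx j 0); rewrite colE.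
Qed.

Lemma col_lead_colspan (R : realType) (n l k : nat) (X : 'M[R]_(n, l)) (j : 'I_l) :
  (j < k)%N -> col j X \in lead_colspan X k.
Proof.
move=> jk; apply: memv_span; apply/mapP; exists j => //.
by rewrite mem_filter jk mem_enum.
Qed.

Lemma col_factor (R : realType) (n k l : nat) (Y : 'M[R]_(n, k)) (Q : 'M[R]_(n, l)) :
  (forall j, exists c, col j Y = Q *m c) -> exists C, Y = Q *m C.
Proof.
move=> /fin_all_exists[c hc]; exists (\matrix_(i, j) c j i 0).
apply/matrixP => i j; have /(congr1 (fun z : 'cV_n => z i 0)) := hc j.
by rewrite !mxE => ->; apply: eq_bigr => a _; rewrite !mxE.
Qed.

(** * Lanczos bidiagonalization, with breakdowns allowed *)

(** For [t = 0] both sides vanish. Hence the Lanczos recurrences below hold unconditionally, even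
    after a breakdown. *)
Lemma enorm_normalizeK (R : realType) (n : nat) (t : 'cV[R]_n) :
  enorm t *: ((enorm t)^-1 *: t) = t.
Proof.
have [t0|t0] := eqVneq (enorm t) 0; last by rewrite scalerA divff // scale1r.
by rewrite (enorm_eq0 t0) !scaler0.
Qed.

Lemma dotv_normalize (R : realType) (n : nat) (t : 'cV[R]_n) :
  enorm t != 0 -> dotv ((enorm t)^-1 *: t) ((enorm t)^-1 *: t) = 1.
Proof. by move=> t0; rewrite dotvZl dotvZr -enorm_sqr; field. Qed.

Lemma normalize_eq0 (R : realType) (n : nat) (t : 'cV[R]_n) :
  enorm t = 0 -> (enorm t)^-1 *: t = 0.
Proof. by move=> t0; rewrite (enorm_eq0 t0) scaler0. Qed.

Section Lanczos.
Variables (R : realType) (m n : nat) (A : 'M[R]_(m, n)) (b : 'cV[R]_m).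

Local Notation p := (lanczos_p A b).
Local Notation q := (lanczos_q A b).
Local Notation alpha := (lanczos_alpha A b).
Local Notation beta := (lanczos_beta A b).

(** The vectors [rp i] and [rq i] are those that step [i] normalizes into [p i] and [q i]. *)
Let rp i := if i is i'.+1 then A *m q i' - alpha i' *: p i' else b.
Let rq i := if i is i'.+1 then A^T *m p i - beta i *: q i' else A^T *m p i.

Lemma lanczos_step i :
  [/\ beta i = enorm (rp i), p i = (beta i)^-1 *: rp i,
      alpha i = enorm (rq i) & q i = (alpha i)^-1 *: rq i].
Proof.
case: i => [|i] //=.
rewrite /lanczos_p /lanczos_q /lanczos_alpha /lanczos_beta /=.
by case: (lanczos A b i) => [[[? ?] ?] ?].
Qed.

Lemma lanczos_pE i : beta i *: p i = rp i.
Proof. by have [-> -> _ _] := lanczos_step i; rewrite enorm_normalizeK. Qed.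

Lemma lanczos_qE i : alpha i *: q i = rq i.
Proof. by have [_ _ -> ->] := lanczos_step i; rewrite enorm_normalizeK. Qed.

Lemma lanczos_p_unit i : beta i != 0 -> dotv (p i) (p i) = 1.
Proof. by have [-> -> _ _] := lanczos_step i; apply: dotv_normalize. Qed.

Lemma lanczos_q_unit i : alpha i != 0 -> dotv (q i) (q i) = 1.
Proof. by have [_ _ -> ->] := lanczos_step i; apply: dotv_normalize. Qed.

Lemma lanczos_p_eq0 i : beta i = 0 -> p i = 0.
Proof. by have [-> -> _ _] := lanczos_step i; apply: normalize_eq0. Qed.

Lemma lanczos_q_eq0 i : alpha i = 0 -> q i = 0.
Proof. by have [_ _ -> ->] := lanczos_step i; apply: normalize_eq0. Qed.

(** With [lanczos_betaS_eq0], this shows that a breakdown propagates: after a first zero coefficient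
    all later coefficients and vectors vanish. *)
Lemma lanczos_alpha_eq0 i : beta i = 0 -> alpha i = 0.
Proof.
move=> b0; have [_ _ -> _] := lanczos_step i; rewrite /rq (lanczos_p_eq0 b0).
by case: i b0 => [|i] b0; rewrite ?b0 mulmx0 ?scale0r ?subr0 enorm0.
Qed.

Lemma lanczos_betaS_eq0 i : alpha i = 0 -> beta i.+1 = 0.
Proof.
move=> a0; have [-> _ _ _] := lanczos_step i.+1.
by rewrite /rp (lanczos_q_eq0 a0) a0 mulmx0 scale0r subr0 enorm0.
Qed.

Lemma lanczos_mulA i : A *m q i = alpha i *: p i + beta i.+1 *: p i.+1.
Proof. by rewrite lanczos_pE /= addrC subrK. Qed.

Lemma lanczos_mulAT0 : A^T *m p 0%N = alpha 0%N *: q 0%N.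
Proof. by rewrite lanczos_qE. Qed.

Lemma lanczos_mulATS i : A^T *m p i.+1 = beta i.+1 *: q i + alpha i.+1 *: q i.+1.
Proof. by rewrite lanczos_qE /= addrC subrK. Qed.

(** A nonzero [alpha i] forces a nonzero [beta i], so both vectors are unit. This settles the
    diagonal case [j = i] of the orthogonality induction. *)
Lemma lanczos_alpha_dotv i :
  alpha i * dotv (p i) (p i) = alpha i * dotv (q i) (q i).
Proof.
have [->|a0] := eqVneq (alpha i) 0; first by rewrite !mul0r.
rewrite lanczos_q_unit // lanczos_p_unit //.
by apply: contra_neq a0; apply: lanczos_alpha_eq0.
Qed.

Lemma lanczos_beta_dotv i :
  beta i.+1 * dotv (p i.+1) (p i.+1) = beta i.+1 * dotv (q i) (q i).
Proof.
have [->|b0] := eqVneq (beta i.+1) 0; first by rewrite !mul0r.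
rewrite lanczos_p_unit // lanczos_q_unit //.
by apply: contra_neq b0; apply: lanczos_betaS_eq0.
Qed.

(* Holds even after a breakdown, since the vectors are then zero. *)
Lemma lanczos_orthogonal i j :
  (j < i)%N -> dotv (p i) (p j) = 0 /\ dotv (q i) (q j) = 0.
Proof.
elim/ltn_ind: i j => -[//|i] IH.
have IHp j l : (j <= i)%N -> (l <= i)%N -> j != l -> dotv (p j) (p l) = 0.
  by move=> ji li; rewrite neq_ltn => /orP[] h; [rewrite dotvC|]; case: (IH _ _ _ h).
have IHq j l : (j <= i)%N -> (l <= i)%N -> j != l -> dotv (q j) (q l) = 0.
  by move=> ji li; rewrite neq_ltn => /orP[] h; [rewrite dotvC|]; case: (IH _ _ _ h).
have orthp j : (j <= i)%N -> dotv (p i.+1) (p j) = 0.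
  move=> ji; have [b0|b0] := eqVneq (beta i.+1) 0.
    by rewrite (lanczos_p_eq0 b0) dotv0l.
  apply: (mulfI b0); rewrite mulr0 -dotvZl lanczos_pE /= dotvBl dotvZl dotv_mull.
  (* [A^T *m p j] combines [q j] and, for positive [j], its predecessor; the predecessor is
     orthogonal to [q i] by induction. *)
  have -> : dotv (q i) (A^T *m p j) = alpha j * dotv (q i) (q j).
    case: j ji => [|j] ji; first by rewrite lanczos_mulAT0 dotvZr.
    rewrite lanczos_mulATS dotvDr !dotvZr (IHq i j) ?gtn_eqF ?mulr0 ?add0r //.
    exact: ltnW.
  have [->|ij] := eqVneq j i; first by rewrite lanczos_alpha_dotv subrr.
  by rewrite IHq 1?eq_sym // IHp 1?eq_sym // !mulr0 subrr.
move=> j; rewrite ltnS => ji; split; first exact: orthp.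
have [a0|a0] := eqVneq (alpha i.+1) 0; first by rewrite (lanczos_q_eq0 a0) dotv0l.
(* The same argument with [A] and its transpose exchanged: [A *m q j] combines [p j] and [p j.+1],
   and [p i.+1] is already known to be orthogonal to [p j]. *)
apply: (mulfI a0); rewrite mulr0 -dotvZl lanczos_qE /= dotvBl dotvZl dotv_mull.
rewrite trmxK lanczos_mulA dotvDr !dotvZr orthp // mulr0 add0r.
have [->|ij] := eqVneq j i; first by rewrite lanczos_beta_dotv subrr.
by rewrite IHq 1?eq_sym // orthp ?mulr0 ?subrr // ltn_neqAle ij.
Qed.

Lemma lanczos_AQ k : A *m lanczos_Q A b k = lanczos_P A b k.+1 *m lanczos_B A b k.
Proof.
apply/matrixP => i j.
have -> : (A *m lanczos_Q A b k) i j = (A *m q j) i 0.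
  by rewrite !mxE; apply: eq_bigr => l _; rewrite mxE.
(* Column [j] of the bidiagonal matrix has its only possibly nonzero entries in rows [j] and [j.+1],
   here [widen_ord (leqnSn k) j] and [lift ord0 j]. *)
rewrite lanczos_mulA !mxE (bigD1 (widen_ord (leqnSn k) j)) //=.
rewrite (bigD1 (lift ord0 j)) //=; last first.
  by rewrite -val_eqE /= /bump leq0n add1n gtn_eqF.
rewrite !mxE /= /bump leq0n add1n !eqxx gtn_eqF // big1 ?addr0.
  by rewrite !(mulrC (p _ _ _)).
move=> l /andP[h1 h2]; rewrite !mxE -!val_eqE /= /bump leq0n add1n in h1 h2 *.
by rewrite (negPf h1) (negPf h2) mulr0.
Qed.

(** By the two recurrences, [A^T *m A] sends each [q i] into the span of its neighbours and itself,
    so every power reaches at most one index further. *)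
Lemma krylov_sub_lanczos k :
  (krylov (A^T *m A) (A^T *m b) k <= lead_colspan (lanczos_Q A b k) k)%VS.
Proof.
(* Indexing by natural numbers lets [l] grow during the induction; the columns of [lanczos_Q A b k]
   enter only at the end. *)
pose S l := <<[seq q i | i <- iota 0 l]>>%VS.
have Sq i l : (i < l)%N -> q i \in S l.
  by move=> il; apply/memv_span/map_f; rewrite mem_iota.
have SS l l' : (l <= l')%N -> (S l <= S l')%VS.
  move=> ll'; apply/span_subvP => _ /mapP[i hi ->]; apply: Sq.
  by move: hi; rewrite mem_iota => /leq_trans; apply.
have SA l v : v \in S l -> (A^T *m A) *m v \in S l.+1.
  apply: (@span_ind _ _ _ (fun v => (A^T *m A) *m v \in S l.+1)).
  - by rewrite mulmx0 mem0v.
  - by move=> a u w hu hw; rewrite mulmxDr -scalemxAr memvD ?memvZ.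
  move=> _ /mapP[i + ->]; rewrite mem_iota /= => il.
  rewrite -mulmxA lanczos_mulA mulmxDr -!scalemxAr.
  apply: memvD; apply: memvZ.
    case: i il => [|i] il; first by rewrite lanczos_mulAT0; apply/memvZ/Sq.
    by rewrite lanczos_mulATS; apply: memvD; apply: memvZ; apply: Sq;
      [do 2!apply: ltnW | apply: ltnW].
  by rewrite lanczos_mulATS; apply: memvD; apply: memvZ; apply: Sq;
    [apply: ltnW |].
have Sit i : iter i (mulmx (A^T *m A)) (A^T *m b) \in S i.+1.
  elim: i => [|i IH]; last exact: SA.
  have -> : b = beta 0%N *: p 0%N by rewrite lanczos_pE.
  by rewrite -scalemxAr lanczos_mulAT0; do 2!apply: memvZ; apply: Sq.
apply/span_subvP => _ /mapP[i + ->]; rewrite mem_iota /= => ik.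
have /subvP/(_ _ (Sit i)) : (S i.+1 <= S k)%VS by apply: SS.
apply/subvP/span_subvP => {Sit}_ /mapP[l + ->]; rewrite mem_iota /= => lk.
suff -> : q l = col (Ordinal lk) (lanczos_Q A b k) by apply: col_lead_colspan.
by apply/matrixP => r c; rewrite !mxE ord1.
Qed.

End Lanczos.

(** * Orthogonal projectors and singular value estimates *)

Lemma dotv_mulmx_orthonormal (R : realType) (n k : nat) (X : 'M[R]_(n, k))
    (g : 'cV_k) :
  X^T *m X = 1%:M -> dotv (X *m g) (X *m g) = dotv g g.
Proof. by move=> X1; rewrite dotv_mull mulmxA X1 mul1mx. Qed.

(** Pythagoras for the orthogonal projector [X *m X^T]. *)
Lemma dotv_complement (R : realType) (n k : nat) (X : 'M[R]_(n, k)) (z : 'cV_n) :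
  X^T *m X = 1%:M ->
  dotv (z - X *m (X^T *m z)) (z - X *m (X^T *m z)) =
  dotv z z - dotv (X^T *m z) (X^T *m z).
Proof.
move=> X1; rewrite !dotvBl !dotvBr dotv_mulmx_orthonormal //.
by rewrite [dotv z (X *m _)]dotvC !dotv_mull subrr subr0.
Qed.

Lemma dotv_svd (R : realType) (m n : nat) (A : 'M[R]_(m, n)) (U : 'M[R]_(m, n))
    (s : 'rV[R]_n) (V : 'M[R]_n) (x : 'cV_n) :
  is_svd A U s V ->
  dotv (A *m x) (A *m x) = \sum_j s 0 j ^+ 2 * (V^T *m x) j 0 ^+ 2.
Proof.
move=> [U1 _ -> _ _]; rewrite -!mulmxA dotv_mulmx_orthonormal //.
rewrite dotvE; apply: eq_bigr => j _.
by rewrite mul_diag_mx mxE -expr2 exprMn.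
Qed.

Lemma dotv_rotate (R : realType) (n : nat) (V : 'M[R]_n) (x : 'cV_n) :
  V^T *m V = 1%:M -> dotv x x = \sum_j (V^T *m x) j 0 ^+ 2.
Proof.
move=> V1; under eq_bigr do rewrite expr2.
by rewrite -dotvE dotv_mulmx_orthonormal // trmxK mulmx1C.
Qed.

(** In the basis [V], the squared length of [A *m x] weights the coordinates by squared singular
    values. Only indices from [i] on survive, and their weights are at most that of [i]. *)
Lemma svd_norm_le (R : realType) (m n : nat) (A : 'M[R]_(m, n)) (U : 'M[R]_(m, n))
    (s : 'rV[R]_n) (V : 'M[R]_n) (i : 'I_n) (x : 'cV_n) :
  is_svd A U s V -> (forall j : 'I_n, (j < i)%N -> (V^T *m x) j 0 = 0) ->
  enorm (A *m x) <= s 0 i * enorm x.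
Proof.
move=> hsvd hx; have [_ V1 _ s0 sle] := hsvd.
apply: enorm_le_dotv => //; rewrite (dotv_svd _ hsvd) (dotv_rotate _ V1) mulr_sumr.
apply: ler_sum => j _; have [ij|ji] := leqP i j.
  by rewrite ler_wpM2r ?sqr_ge0 // ler_sqr ?nnegrE // sle.
by rewrite hx // expr0n !mulr0.
Qed.

Lemma svd_norm_ge (R : realType) (m n : nat) (A : 'M[R]_(m, n)) (U : 'M[R]_(m, n))
    (s : 'rV[R]_n) (V : 'M[R]_n) (i : 'I_n) (x : 'cV_n) :
  is_svd A U s V -> (forall j : 'I_n, (i < j)%N -> (V^T *m x) j 0 = 0) ->
  s 0 i * enorm x <= enorm (A *m x).
Proof.
move=> hsvd hx; have [_ V1 _ s0 sle] := hsvd.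
rewrite -ler_sqr ?nnegrE ?mulr_ge0 ?enorm_ge0 // exprMn !enorm_sqr.
rewrite (dotv_svd _ hsvd) (dotv_rotate _ V1) mulr_sumr.
apply: ler_sum => j _; have [ji|ij] := leqP j i.
  by rewrite ler_wpM2r ?sqr_ge0 // ler_sqr ?nnegrE // sle.
by rewrite hx // expr0n !mulr0.
Qed.

Lemma ex_kernel_vector (R : realType) (k : nat) (M : 'M[R]_(k, k.+1)) :
  exists2 d : 'cV_k.+1, d != 0 & M *m d = 0.
Proof.
(* [kermx] is a left kernel, hence the transposes. The rank is at most [k], one less than the number
   of columns of [M]. *)
have : kermx M^T != 0.
  rewrite -mxrank_eq0 mxrank_ker subn_eq0 -ltnNge ltnS.
  exact: rank_leq_col.
case/rowV0Pn => v /sub_kermxP vM v0; exists v^T.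
  by apply: contra_neq v0 => v0; rewrite -[v]trmxK v0 trmx0.
by rewrite -[M]trmxK -trmx_mul vM trmx0.
Qed.

(* Among any k+1 singular directions, one combination is killed by Q^T. *)
Lemma svd_low_rank_lower_bound (R : realType) (m n k : nat) (A : 'M[R]_(m, n))
    (U : 'M[R]_(m, n)) (s : 'rV[R]_n) (V : 'M[R]_n) (B : 'M[R]_(m, k))
    (Q : 'M[R]_(k, n)) (hkn : (k < n)%N) :
  is_svd A U s V -> s 0 (Ordinal hkn) <= spectral_norm (A - B *m Q).
Proof.
move=> hsvd; have [_ V1 _ _ _] := hsvd.
(* Multiplying by [pid_mx k.+1] keeps the first [k.+1] columns of [V], so [d] holds coordinates with
   respect to them. *)
have [d d0 Qd] := ex_kernel_vector (Q *m (V *m pid_mx k.+1)).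
pose x := V *m (pid_mx k.+1 *m d).
have Vx : V^T *m x = pid_mx k.+1 *m d by rewrite mulmxA V1 mul1mx.
have x0 : 0 < enorm x.
  rewrite lt_neqAle enorm_ge0 andbT eq_sym; apply: contra_neq d0 => /enorm_eq0 x0.
  have : pid_mx k.+1 *m (pid_mx k.+1 *m d : 'cV_n) = d.
    by rewrite mulmxA pid_mx_id // pid_mx_1 mul1mx.
  by rewrite -Vx x0 !mulmx0.
have Mx : (A - B *m Q) *m x = A *m x.
  have Qx : Q *m x = 0 by rewrite -Qd /x !mulmxA.
  by rewrite mulmxBl -mulmxA Qx mulmx0 subr0.
rewrite -(ler_pM2r x0); apply: le_trans (enorm_mulmx _ _); rewrite Mx.
apply: (svd_norm_ge hsvd) => j /= kj; rewrite Vx mxE big1 // => l _.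
by rewrite mxE [(j < _)%N]ltnNge kj andbF mul0r.
Qed.

(* sin Theta bounds (1 - Y Y^T) on range X, hence, by duality, X^T (1 - Y Y^T). *)
Lemma sin_Theta_bound (R : realType) (n k : nat) (X Y : 'M[R]_(n, k))
    (W : 'M[R]_k) (c : 'rV[R]_k) (Z : 'M[R]_k) (z : 'cV_n) :
  (0 < k)%N -> X^T *m X = 1%:M -> Y^T *m Y = 1%:M -> is_svd (X^T *m Y) W c Z ->
  enorm (X^T *m (z - Y *m (Y^T *m z)))
    <= spectral_norm (sin_Theta (map_mx (@acos R) c)) * enorm z.
Proof.
move=> k0 X1 Y1 hsvd; have [W1 Z1 E c0 _] := hsvd.
set s := spectral_norm _.
pose P (v : 'cV_n) := v - Y *m (Y^T *m v).
(* Diagonalizing [Y^T *m X] as [Z *m diag_mx c *m W^T] turns the residual into a sum whose weights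
   are the squared sines of the angles. *)
have PE v : dotv (P (X *m v)) (P (X *m v)) =
    \sum_j (1 - c 0 j ^+ 2) * (W^T *m v) j 0 ^+ 2.
  rewrite dotv_complement // dotv_mulmx_orthonormal // (dotv_rotate _ W1).
  have -> : Y^T *m (X *m v) = Z *m (diag_mx c *m (W^T *m v)).
    rewrite mulmxA -[Y^T *m X]trmxK trmx_mul trmxK E !trmx_mul trmxK tr_diag_mx.
    by rewrite !mulmxA.
  rewrite dotv_mulmx_orthonormal // dotvE -sumrB; apply: eq_bigr => j _.
  by rewrite mul_diag_mx [X in X * X]mxE; ring.
(* Choosing [v] as column [j] of [W] isolates one weight, which is therefore nonnegative. This puts
   [c 0 j] in the domain where [sin_acos] applies. *)
have c1 j : c 0 j ^+ 2 <= 1.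
  have := dotv_ge0 (P (X *m (W *m delta_mx j 0))).
  rewrite PE mulmxA W1 mul1mx (bigD1 j) //= mxE !eqxx expr1n mulr1 big1 => [|i ij].
    by rewrite addr0 subr_ge0.
  by rewrite mxE (negPf ij) expr0n mulr0.
have cs j : 1 - c 0 j ^+ 2 <= s ^+ 2.
  have := spectral_norm_diag_ge (map_mx (@sin R) (map_mx (@acos R) c)) j.
  rewrite !mxE sin_acos; last first.
    rewrite (le_trans _ (c0 j)) ?lerN10 //=.
    by rewrite -ler_sqr ?nnegrE // expr1n.
  rewrite ger0_norm ?sqrtr_ge0 // => h; rewrite -[X in X <= _]sqr_sqrtr ?subr_ge0 //.
  by rewrite ler_sqr ?nnegrE ?sqrtr_ge0 // spectral_norm_ge0.
have PX v : enorm (P (X *m v)) <= s * enorm v.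
  apply: enorm_le_dotv; first exact: spectral_norm_ge0.
  rewrite PE (dotv_rotate v W1) mulr_sumr ler_sum // => j _.
  by rewrite ler_wpM2r ?sqr_ge0.
have Psym u v : dotv (P u) v = dotv u (P v).
  by rewrite dotvBl dotvBr !dotv_mull trmxK.
rewrite -/(P z); set g := X^T *m P z.
have [g0|g0] := eqVneq (enorm g) 0.
  by rewrite g0 mulr_ge0 ?enorm_ge0 ?spectral_norm_ge0.
have gp : 0 < enorm g by rewrite lt_neqAle eq_sym g0 enorm_ge0.
(* Duality: the squared length of [g] is [dotv (P z) (X *m g)], which equals [dotv z (P (X *m g))].
   Cauchy-Schwarz and [PX] bound it, and one factor [enorm g] cancels. *)
rewrite -(ler_pM2r gp) -expr2 enorm_sqr {1}/g dotv_mull trmxK Psym.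
apply: le_trans (dotv_le_enorm _ _) _.
rewrite mulrC mulrAC ler_wpM2r ?enorm_ge0 //.
Qed.

(** * The Krylov projector *)

(** The factor [C] is square with [C^T *m C = 1%:M], hence orthogonal, and cancels in
    [Q *m C *m C^T *m Q^T]. *)
Lemma projector_unique (R : realType) (n k : nat) (Y Q : 'M[R]_(n, k))
    (C : 'M[R]_k) :
  Y^T *m Y = 1%:M -> Q^T *m Q = 1%:M -> Y = Q *m C -> Y *m Y^T = Q *m Q^T.
Proof.
move=> Y1 Q1 E; have C1 : C^T *m C = 1%:M.
  by rewrite -Y1 E trmx_mul -mulmxA (mulmxA Q^T) Q1 mul1mx.
by rewrite E trmx_mul -mulmxA (mulmxA C) (mulmx1C C1) mul1mx.
Qed.

(** The [k] orthonormal columns of [Y] factor through the [k] columns of [Q], so the Gram matrix of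
    [Q] is invertible. Thus no [q i] is zero, and the mutually orthogonal columns of [Q] are
    orthonormal. *)
Lemma lanczos_Q_projector (R : realType) (m n k : nat) (A : 'M[R]_(m, n))
    (b : 'cV[R]_m) (Y : 'M[R]_(n, k)) :
  orthonormal_basis Y (krylov (A^T *m A) (A^T *m b) k) ->
  lanczos_Q A b k *m (lanczos_Q A b k)^T = Y *m Y^T.
Proof.
move=> [Y1 YK]; set Q := lanczos_Q A b k.
have [C YQC] : exists C, Y = Q *m C.
  apply: col_factor => j; apply: (@mem_lead_colspan _ _ _ Q k).
  apply: (subvP (krylov_sub_lanczos A b k)); rewrite -YK.
  exact: col_lead_colspan.
have QQE i j : (Q^T *m Q) i j = dotv (lanczos_q A b i) (lanczos_q A b j).
  by rewrite mxE dotvE; apply: eq_bigr => l _; rewrite !mxE.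
have alpha0 i : lanczos_alpha A b (i : 'I_k) != 0.
  have Qu : (Q^T *m Q) \in unitmx.
    have : C^T *m (Q^T *m Q) *m C = 1%:M by rewrite -Y1 YQC trmx_mul !mulmxA.
    move=> /mulmx1_unit[]; rewrite unitmx_mul => /andP[] //.
  (* A zero [q i] would give the invertible Gram matrix a zero row. *)
  apply/eqP => /lanczos_q_eq0 q0.
  have : row i (Q^T *m Q) = 0 by apply/rowP => j; rewrite mxE QQE q0 dotv0l mxE.
  rewrite rowE => /(congr1 (mulmx^~ (invmx (Q^T *m Q)))).
  rewrite mulmxK // mul0mx => /matrixP/(_ 0 i).
  by rewrite !mxE !eqxx => /eqP; rewrite oner_eq0.
have Q1 : Q^T *m Q = 1%:M.
  apply/matrixP => i j; rewrite QQE mxE.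
  have [<-|] := eqVneq i j; first by rewrite lanczos_q_unit.
  rewrite -val_eqE neq_ltn => /orP[] h; first rewrite dotvC;
    by have [_ ->] := lanczos_orthogonal A b h.
by rewrite (projector_unique Y1 Q1 YQC).
Qed.

(** * The two bounds on [gamma] *)

Theorem theorem2p2 (R : realType) (m n k : nat)
    (A : 'M[R]_(m, n)) (b : 'cV[R]_m)
    (U : 'M[R]_(m, n)) (sigma : 'rV[R]_n) (V : 'M[R]_n)
    (theta : 'rV[R]_k)
    (hmn : (n <= m)%N) (hn : (1 < n)%N)
    (hsvd : is_svd A U sigma V)
    (hsimple : forall i j : 'I_n, (i < j)%N -> sigma 0 j < sigma 0 i)
    (hpos : forall j : 'I_n, 0 < sigma 0 j)
    (hb : forall j : 'I_n, ((col j U)^T *m b) 0 0 != 0)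
    (hill : severely_ill_posed sigma \/ moderately_ill_posed sigma)
    (hk1 : (0 < k)%N) (hkn : (k < n)%N)
    (htheta : canonical_angles (lead_colspan V k)
                (krylov (A^T *m A) (A^T *m b) k) theta) :
  let gamma := spectral_norm
    (A - lanczos_P A b k.+1 *m lanczos_B A b k *m (lanczos_Q A b k)^T) in
  sigma 0 (Ordinal hkn) <= gamma /\
  gamma <= sigma 0 (Ordinal hkn)
           + sigma 0 (Ordinal (ltnW hn)) * spectral_norm (sin_Theta theta).
Proof.
have [X [Y [W [c [Z [[X1 XV] oY hXY thetaE]]]]]] := htheta.
have [Y1 _] := oY; have [_ V1 _ s0 _] := hsvd.
have n0 : (0 < n)%N := ltnW hn.
rewrite thetaE -lanczos_AQ => gamma; split.
  (* The subtracted matrix factors through dimension [k], so the bound for approximations of rank at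
     most [k] applies. *)
  by rewrite /gamma lanczos_AQ; apply: svd_low_rank_lower_bound hsvd.
have gE z : (A - A *m lanczos_Q A b k *m (lanczos_Q A b k)^T) *m z
    = A *m (z - Y *m (Y^T *m z)).
  rewrite -[A *m _ *m _]mulmxA (lanczos_Q_projector oY) mulmxBl mulmxBr.
  by rewrite !mulmxA.
apply: spectral_norm_le => // z z1; rewrite gE.
set y := z - _; pose g := X^T *m y.
have hg : enorm g <= spectral_norm (sin_Theta (map_mx (@acos R) c)).
  by have := sin_Theta_bound z hk1 X1 Y1 hXY; rewrite z1 mulr1.
(* Removing an orthogonal projection never lengthens a vector; this is used below for both [X] and
   [Y]. *)
have le_complement (M : 'M[R]_(n, k)) v :
    M^T *m M = 1%:M -> enorm (v - M *m (M^T *m v)) <= enorm v.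
  move=> M1; rewrite -[leRHS]mul1r; apply: enorm_le_dotv => //.
  by rewrite expr1n mul1r dotv_complement // gerBl dotv_ge0.
have -> : A *m y = A *m (y - X *m g) + A *m (X *m g).
  by rewrite -mulmxDr subrK.
apply: le_trans (enormD _ _) _; apply: lerD.
  (* The vector [y - X *m g] is orthogonal to the first [k] right singular vectors. [Ordinal hkn]
     has index [k], which is the singular value numbered [k + 1] from one. *)
  apply: (le_trans (svd_norm_le (i := Ordinal hkn) hsvd _)) => [j jk|].
    have [a Va] : exists a, col j V = X *m a.
      apply: (@mem_lead_colspan _ _ _ _ k); rewrite XV; exact: col_lead_colspan.
    have -> (x : 'cV_n) : (V^T *m x) j 0 = dotv (col j V) x.
      by rewrite dotvE mxE; apply: eq_bigr => l _; rewrite !mxE.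
    by rewrite Va dotv_mull mulmxBr mulmxA X1 mul1mx subrr dotv0r.
  rewrite -[leRHS]mulr1 ler_wpM2l // -z1.
  by apply: le_trans (le_complement X y X1) (le_complement Y z Y1).
(* At index [0] the vanishing condition is vacuous, which gives the largest singular value as a
   bound for [A]. *)
apply: (le_trans (svd_norm_le (i := Ordinal n0) hsvd _)) => //.
rewrite (bool_irrelevance n0 (ltnW hn)) ler_wpM2l //.
by rewrite enormE dotv_mulmx_orthonormal // -enormE.
Qed.
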